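(* Let $d\ge 1$ and let $G=(V,E)$ be a graph. Then $G$ belongs to $\textsc{And}(d)$ if and only if $G$ is the intersection graph of a family of boxes in $\mathbb{R}^{2d}$ (one box $S_v$ per vertex $v$, with $uv\in E$ iff $S_u\cap S_v\neq\emptyset$ for distinct $u,v$) in which each box can be described as $$S_v=\times_{i=1}^d\big([p_i,R_i]\times[-p_i,-L_i]\big)$$ with $p_i,R_i,L_i>0$ for all $i\in\{1,\dots,d\}$ (the numbers $p_i,R_i,L_i$ depending on $v$, and the factors being closed intervals with the indicated endpoints).
   Context: All graphs are finite, simple (undirected, loopless, without parallel edges) and connected. A box in $\mathbb{R}^d$ is a Cartesian product of $d$ closed intervals. An $\textsc{And}$-realization of a graph $G=(V,E)$ in $\mathbb{R}^d$ is a family $\{(B_v,p_v):v\in V\}$ where each $B_v$ is a box in $\mathbb{R}^d$ and $p_v\in B_v$ is a point (the representative element), such that for all distinct $u,v\in V$: $uv\in E$ if and only if $p_v\in B_u$ and $p_u\in B_v$. $\textsc{And}(d)$ denotes the class of graphs admitting an $\textsc{And}$-realization in $\mathbb{R}^d$. *)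

(* Defs.v *)
From HB Require Import structures.
From mathcomp Require Import all_boot all_order all_algebra.
From mathcomp Require Import classical_sets reals.

Set Implicit Arguments.
Unset Strict Implicit.
Unset Printing Implicit Defensive.

Import Order.TTheory GRing.Theory Num.Theory.
Local Open Scope classical_set_scope.
Local Open Scope ring_scope.

Record graph := Graph {
  vertex :> finType;
  edge : rel vertex;
  edge_sym : symmetric edge;
  edge_irrefl : irreflexive edge;
  edge_connected : forall u v : vertex, connect edge u v
}.

(* The intervals are required to be non-empty. *)
Definition is_box (R : realType) (n : nat) (B : set 'rV[R]_n) : Prop :=
  exists a b : 'rV[R]_n,
    (forall i, a 0 i <= b 0 i) /\
    B = [set x : 'rV[R]_n | forall i, x 0 i \in `[a 0 i, b 0 i]].

Definition And_realization (R : realType) (d : nat) (G : graph)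
    (B : G -> set 'rV[R]_d) (p : G -> 'rV[R]_d) : Prop :=
  [/\ forall v, is_box (B v),
      forall v, B v (p v) &
      forall u v, u != v -> (edge u v <-> B u (p v) /\ B v (p u))].

Definition And (R : realType) (d : nat) (G : graph) : Prop :=
  exists (B : G -> set 'rV[R]_d) (p : G -> 'rV[R]_d), And_realization B p.

Definition is_intersection_graph (T : Type) (G : graph) (S : G -> set T) : Prop :=
  forall u v, u != v -> (edge u v <-> S u `&` S v !=set0).

Lemma coord1_subproof (d : nat) (i : 'I_d) : (2 * i < 2 * d)%N.
Proof. by rewrite ltn_mul2l ltn_ord. Qed.

Lemma coord2_subproof (d : nat) (i : 'I_d) : ((2 * i).+1 < 2 * d)%N.
Proof. by rewrite !mul2n ltn_Sdouble ltn_ord. Qed.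

(* R^(2d) is read as (R^2)^d: the i-th factor R^2 occupies the consecutive
   coordinates 2i and 2i+1 (counting from 0). *)
Definition coord1 (d : nat) (i : 'I_d) : 'I_(2 * d) :=
  Ordinal (coord1_subproof i).

Definition coord2 (d : nat) (i : 'I_d) : 'I_(2 * d) :=
  Ordinal (coord2_subproof i).

(* The product over i of [p_i, r_i] x [-p_i, -l_i]. Nothing here forces
   l_i <= p_i <= r_i; it follows once the set
   satisfies [is_box], which makes it non-empty. *)
Definition paired_box (R : realType) (d : nat) (p r l : 'rV[R]_d) :
    set 'rV[R]_(2 * d) :=
  [set x : 'rV[R]_(2 * d) | forall i : 'I_d,
     x 0 (coord1 i) \in `[p 0 i, r 0 i] /\
     x 0 (coord2 i) \in `[- p 0 i, - l 0 i]].

(* Main.v *)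
(** In one coordinate, [p, r] x [-p, -l] and [p', r'] x [-p', -l'] (with
    l <= p <= r and l' <= p' <= r') meet exactly when max p p' <= min r r' and
    max l l' <= min p p', that is, when p lies in [l', r'] and p' lies in
    [l, r]. Hence the boxes of R^(2d) encode the pairs made of the point p and
    the box with corners l and r; positivity costs nothing, because a finite
    realization can be translated into the positive orthant. *)

Require Import Defs.
From HB Require Import structures.
From mathcomp Require Import all_boot all_order all_algebra.
From mathcomp Require Import classical_sets reals.
From mathcomp Require Import boolp lra.

Set Implicit Arguments.
Unset Strict Implicit.
Unset Printing Implicit Defensive.

Import Order.TTheory GRing.Theory Num.Theory.
Local Open Scope classical_set_scope.
Local Open Scope ring_scope.

Lemma half_ord_subproof (d : nat) (j : 'I_(2 * d)) : (j./2 < d)%N.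
Proof. by rewrite ltn_half_double -mul2n. Qed.

Definition half_ord (d : nat) (j : 'I_(2 * d)) : 'I_d :=
  Ordinal (half_ord_subproof j).

Lemma half_ord_coord1 (d : nat) (i : 'I_d) : half_ord (coord1 i) = i.
Proof. by apply: val_inj; rewrite /= mul2n doubleK. Qed.

Lemma half_ord_coord2 (d : nat) (i : 'I_d) : half_ord (coord2 i) = i.
Proof. by apply: val_inj; rewrite /= mul2n uphalf_double. Qed.

Lemma coord_half_ord (d : nat) (j : 'I_(2 * d)) :
  j = if odd j then coord2 (half_ord j) else coord1 (half_ord j).
Proof.
apply: val_inj; rewrite -[LHS]odd_double_half.
by case: (odd j); rewrite /= -mul2n.
Qed.

(** Used both for the corners of a paired box and for a common point of two such boxes. *)
Definition interleave (R : realType) (d : nat) (f g : 'I_d -> R) :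
    'rV[R]_(2 * d) :=
  \row_j if odd j then g (half_ord j) else f (half_ord j).

Lemma interleave_coord1 (R : realType) (d : nat) (f g : 'I_d -> R) (i : 'I_d) :
  interleave f g 0 (coord1 i) = f i.
Proof. by rewrite mxE half_ord_coord1 /= mul2n odd_double. Qed.

Lemma interleave_coord2 (R : realType) (d : nat) (f g : 'I_d -> R) (i : 'I_d) :
  interleave f g 0 (coord2 i) = g i.
Proof. by rewrite mxE half_ord_coord2 /= mul2n odd_double. Qed.

Lemma forall_coordP (d : nat) (P : 'I_(2 * d) -> Prop) :
  (forall j, P j) <-> (forall i, P (coord1 i) /\ P (coord2 i)).
Proof.
split=> [H i|H j]; first by split.
by rewrite (coord_half_ord j); case: (odd j); have [] := H (half_ord j).
Qed.

Lemma is_box_nonempty (R : realType) (n : nat) (B : set 'rV[R]_n) :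
  is_box B -> B !=set0.
Proof.
move=> [a [b [leab ->]]]; exists a => i /=.
by rewrite in_itv /= lexx leab.
Qed.

(** A point of the box gives [p <= r] through its coordinate [coord1 i] and [l <= p] through
    [coord2 i]. *)
Lemma is_box_paired_boxP (R : realType) (d : nat) (p r l : 'rV[R]_d) :
  is_box (paired_box p r l) <-> forall i, l 0 i <= p 0 i <= r 0 i.
Proof.
split=> [/is_box_nonempty[x xS] i|lepr].
  by have [] := xS i; rewrite !in_itv /=; lra.
exists (interleave (fun i => p 0 i) (fun i => - p 0 i)).
exists (interleave (fun i => r 0 i) (fun i => - l 0 i)); split.
  apply/forall_coordP => i; rewrite !interleave_coord1 !interleave_coord2.
  by have := lepr i; split; lra.
apply/seteqP; split=> x.
  move=> xS; apply/forall_coordP => i.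
  by rewrite !interleave_coord1 !interleave_coord2; exact: xS.
move=> /forall_coordP xS i; have := xS i.
by rewrite !interleave_coord1 !interleave_coord2.
Qed.

Lemma paired_box_meetP (R : realType) (d : nat) (p r l p' r' l' : 'rV[R]_d) :
  (forall i, l 0 i <= p 0 i <= r 0 i) ->
  (forall i, l' 0 i <= p' 0 i <= r' 0 i) ->
  paired_box p r l `&` paired_box p' r' l' !=set0 <->
  (forall i, p' 0 i \in `[l 0 i, r 0 i]) /\
  (forall i, p 0 i \in `[l' 0 i, r' 0 i]).
Proof.
move=> lepr lepr'; split=> [[x [xS xS']]|[p'B pB']].
  (* The even coordinate of [x] is at least [p'] and at most [r]; the odd one is at least [- p'] and
     at most [- l]. Hence [l <= p' <= r], and symmetrically for [p]. *)
  split=> i; have [] := xS i; have [] := xS' i; rewrite !in_itv /=; lra.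
(* The lowest corner of the intersection: each coordinate is the larger of the two left endpoints,
   and the larger of [- p] and [- p'] is [- min p p']. *)
exists (interleave (fun i => Num.max (p 0 i) (p' 0 i))
                   (fun i => - Num.min (p 0 i) (p' 0 i))).
by split=> i; rewrite interleave_coord1 interleave_coord2 !in_itv /=;
  have := lepr i; have := lepr' i; have := p'B i; have := pB' i;
  rewrite !in_itv /=; case: (leP (p 0 i) (p' 0 i)); lra.
Qed.

Lemma exists_positive_shift (R : realType) (T : finType) (d : nat)
    (a : T -> 'rV[R]_d) : exists c : R, forall v i, 0 < a v 0 i + c.
Proof.
(* The double sum dominates every single [|a v 0 i|], and the 1 makes the inequality strict. *)
exists (1 + \sum_v \sum_i `|a v 0 i|) => v i.
have le_row : `|a v 0 i| <= \sum_j `|a v 0 j|.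
  by rewrite (bigD1 i) //= lerDl sumr_ge0.
have le_all : \sum_j `|a v 0 j| <= \sum_w \sum_j `|a w 0 j|.
  by rewrite [leRHS](bigD1 v) //= lerDl sumr_ge0 // => w _; rewrite sumr_ge0.
have := ler_norm (- a v 0 i); rewrite normrN; lra.
Qed.

Theorem theorem1 (R : realType) (d : nat) (hd : (1 <= d)%N) (G : graph) :
  And R d G <->
  exists S : G -> set 'rV[R]_(2 * d),
    [/\ forall v, is_box (S v),
        is_intersection_graph S &
        forall v, exists p r l : 'rV[R]_d,
          (forall i, [/\ 0 < p 0 i, 0 < r 0 i & 0 < l 0 i]) /\
          S v = paired_box p r l].
Proof.
split=> [[B [p [boxB pB edgeP]]]|[S [boxS edgeP prlS]]].
- have [l /choice[r lrB]] := choice boxB.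
  (* Shifting the lower corners above 0 suffices, since [l <= p <= r] carries positivity over to [p]
     and [r]. *)
  have [c c_gt0] := exists_positive_shift l.
  pose t : 'rV[R]_d := const_mx c.
  have lepr v i : l v 0 i <= p v 0 i <= r v 0 i.
    by have := pB v; rewrite (lrB v).2 => /(_ i); rewrite in_itv.
  have lepr_shift v i :
      (l v + t) 0 i <= (p v + t) 0 i <= (r v + t) 0 i.
    by rewrite !mxE !lerD2r lepr.
  exists (fun v => paired_box (p v + t) (r v + t) (l v + t)); split.
  + by move=> v; apply/is_box_paired_boxP.
  + move=> u v neq_uv; rewrite edgeP // paired_box_meetP //.
    rewrite (lrB u).2 (lrB v).2 /=.
    by split=> -[Hu Hv]; split=> i; have := Hu i; have := Hv i;
      rewrite !in_itv /= !mxE !lerD2r.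
  + move=> v; exists (p v + t), (r v + t), (l v + t); split=> // i.
    by have := c_gt0 v i; have := lepr v i; rewrite !mxE; split; lra.
- have [p /choice[r /choice[l prlP]]] := choice prlS.
  (* The order of the three numbers comes from [boxS]: a box is non-empty. *)
  have lepr v : forall i, l v 0 i <= p v 0 i <= r v 0 i.
    by apply/is_box_paired_boxP; rewrite -(prlP v).2.
  exists (fun v => [set x | forall i, x 0 i \in `[l v 0 i, r v 0 i]]), p.
  split=> [v|v i|u v neq_uv] /=.
  + exists (l v), (r v); split=> // i.
    by have /andP[lep ler] := lepr v i; exact: le_trans ler.
  + by rewrite in_itv /= lepr.
  + by rewrite edgeP // (prlP u).2 (prlP v).2 paired_box_meetP.
Qed.
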